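(* Let $(\mathcal{A},\mu,N)$ be a Nijenhuis mock-Lie algebra and let $(\mu_t,N_t)$, $\mu_t=\sum_{i\ge0}\mu_it^i$, $N_t=\sum_{i\ge0}N_it^i$, be a one-parameter formal deformation of $(\mathcal{A},\mu,N)$. If $(\mu_n,N_n)$ is the $n$-infinitesimal of the deformation, then $(\mu_n,N_n)$ is a $2$-cocycle of $(\mathcal{A},\mu,N)$.
   Context: All vector spaces are over a field $K$ of characteristic zero. A mock-Lie algebra $(\mathcal{A},\mu)$ is a vector space with a commutative bilinear map $\mu$ such that $\mu(x,\mu(y,z))+\mu(y,\mu(z,x))+\mu(z,\mu(x,y))=0$. A Nijenhuis mock-Lie algebra $(\mathcal{A},\mu,N)$ is a mock-Lie algebra with a linear map $N:\mathcal{A}\to\mathcal{A}$ such that $\mu(N(x),N(y))+N^2(\mu(x,y))=N(\mu(N(x),y))+N(\mu(x,N(y)))$. The same definitions are used over $K[[t]]$. A one-parameter formal deformation of $(\mathcal{A},\mu,N)$ is a pair of power series $\mu_t=\sum_{i\ge0}\mu_it^i$, $N_t=\sum_{i\ge0}N_it^i$ with $\mu_i\in\mathrm{Hom}(\mathcal{A}\otimes\mathcal{A},\mathcal{A})$, $N_i\in\mathrm{Hom}(\mathcal{A},\mathcal{A})$, $(\mu_0,N_0)=(\mu,N)$, such that $(\mathcal{A}[[t]],\mu_t,N_t)$ (with $\mu_t,N_t$ extended $K[[t]]$-linearly) is a Nijenhuis mock-Lie algebra. The $n$-infinitesimal ($n\ge1$) of the deformation is $(\mu_n,N_n)$ when this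 is the first non-zero term after $(\mu_0,N_0)$, i.e. $(\mu_i,N_i)=(0,0)$ for $0<i<n$ and $(\mu_n,N_n)\neq(0,0)$. A pair $(\mu_1,N_1)$ with $\mu_1\in\mathrm{Hom}(\mathcal{A}\otimes\mathcal{A},\mathcal{A})$, $N_1\in\mathrm{Hom}(\mathcal{A},\mathcal{A})$ is a $2$-cocycle of $(\mathcal{A},\mu,N)$ if for all $x,y,z\in\mathcal{A}$: $$\mu(x,\mu_1(y,z))+\mu_1(x,\mu(y,z))+\mu(z,\mu_1(x,y))+\mu_1(z,\mu(x,y))+\mu_1(y,\mu(z,x))+\mu(y,\mu_1(z,x))=0,$$ and $$\begin{aligned}&\mu_1(N(x),N(y))+\mu(N_1(x),N(y))+\mu(N(x),N_1(y))-N_1(\mu(N(x),y))-N(\mu(N_1(x),y))-N(\mu_1(N(x),y))\\&-N_1(\mu(x,N(y)))-N(\mu_1(x,N(y)))-N(\mu(x,N_1(y)))+N_1N(\mu(x,y))+NN_1(\mu(x,y))+N^2(\mu_1(x,y))=0.\end{aligned}$$ *)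

(* Defs.v *)
From HB Require Import structures.
From mathcomp Require Import all_boot all_algebra.
From mathcomp Require Import boolp.

Set Implicit Arguments.
Unset Strict Implicit.
Unset Printing Implicit Defensive.

Import GRing.Theory.
Local Open Scope ring_scope.

(** Nijenhuis mock-Lie algebras over a commutative ring, so that the same
    definition applies over [K] and over [K[[t]]]. *)

Definition mock_lie (R : comNzRingType) (A : lmodType R)
    (mu : {bilinear A -> A -> A}) : Prop :=
  (forall x y, mu x y = mu y x) /\
  (forall x y z, mu x (mu y z) + mu y (mu z x) + mu z (mu x y) = 0).

Definition nijenhuis_mock_lie (R : comNzRingType) (A : lmodType R)
    (mu : {bilinear A -> A -> A}) (N : {linear A -> A}) : Prop :=
  mock_lie mu /\
  (forall x y, mu (N x) (N y) + N (N (mu x y))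
             = N (mu (N x) y) + N (mu x (N y))).

(** Formal power series [\sum_n f_n t^n] with coefficients in [V].  The library
    has none, so [fps R] is made a commutative ring ([R[[t]]]) when [R] is one,
    and [fps V] ([V[[t]]]) an [fps R]-module when [V] is an [R]-module. *)

Record fps (V : Type) := Fps { fps_coef : nat -> V }.

Lemma fpsP (V : Type) (f g : fps V) : fps_coef f =1 fps_coef g -> f = g.
Proof. by case: f g => [f] [g] /= /funext ->. Qed.

HB.instance Definition _ (V : Type) := gen_eqMixin (fps V).
HB.instance Definition _ (V : Type) := gen_choiceMixin (fps V).

Section Triangle.
Variable V : nmodType.

Lemma sum_ord_rev n (G : nat -> nat -> V) :
  \sum_(i < n.+1) G i (n - i)%N = \sum_(i < n.+1) G (n - i)%N i.
Proof.
rewrite (reindex_inj rev_ord_inj) /=.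
by apply: eq_bigr => i _; rewrite subSS subKn // -ltnS.
Qed.

Lemma sum_triangle_swap n (F : nat -> nat -> nat -> V) :
  \sum_(i < n.+1) \sum_(j < (n - i).+1) F i j (n - i - j)%N
  = \sum_(j < n.+1) \sum_(i < (n - j).+1) F i j (n - j - i)%N.
Proof.
have widen i (G : nat -> V) : (i < n.+1)%N ->
    \sum_(j < (n - i).+1) G j = \sum_(j < n.+1 | (i + j <= n)%N) G j.
  rewrite ltnS => lein.
  rewrite (big_ord_widen n.+1) ?ltnS ?leq_subr //.
  by apply: eq_bigl => j; rewrite ltnS leq_subRL.
under eq_bigr => i _ do rewrite (widen i (fun j => F i j (n - i - j)%N)) //.
under [RHS]eq_bigr => j _ do rewrite (widen j (fun i => F i j (n - j - i)%N)) //.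
rewrite (exchange_big_dep xpredT) //=.
apply: eq_bigr => j _; apply: eq_big => i; first by rewrite addnC.
by move=> _; rewrite subnAC.
Qed.

Lemma sum_triangle_assoc n (F : nat -> nat -> nat -> V) :
  \sum_(j < n.+1) \sum_(i < j.+1) F i (j - i)%N (n - j)%N
  = \sum_(i < n.+1) \sum_(j < (n - i).+1) F i j (n - i - j)%N.
Proof.
rewrite (sum_ord_rev n (fun j m => \sum_(i < j.+1) F i (j - i)%N m)).
rewrite -(sum_triangle_swap n (fun i j k => F i k j)).
apply: eq_bigr => i _.
by rewrite (sum_ord_rev (n - i) (fun j k => F i k j)).
Qed.

End Triangle.

Section FpsZmod.
Variable V : zmodType.

Definition fps_zero : fps V := Fps (fun _ => 0).
Definition fps_opp (f : fps V) : fps V := Fps (fun n => - fps_coef f n).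
Definition fps_add (f g : fps V) : fps V :=
  Fps (fun n => fps_coef f n + fps_coef g n).

Lemma fps_addA : associative fps_add.
Proof. by move=> f g h; apply: fpsP => n /=; rewrite addrA. Qed.
Lemma fps_addC : commutative fps_add.
Proof. by move=> f g; apply: fpsP => n /=; rewrite addrC. Qed.
Lemma fps_add0 : left_id fps_zero fps_add.
Proof. by move=> f; apply: fpsP => n /=; rewrite add0r. Qed.
Lemma fps_addN : left_inverse fps_zero fps_opp fps_add.
Proof. by move=> f; apply: fpsP => n /=; rewrite addNr. Qed.

HB.instance Definition _ :=
  GRing.isZmodule.Build (fps V) fps_addA fps_addC fps_add0 fps_addN.

Lemma fps_coefD (f g : fps V) n :
  fps_coef (f + g) n = fps_coef f n + fps_coef g n.
Proof. by []. Qed.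

End FpsZmod.

Section FpsRing.
Variable R : comNzRingType.

Definition fps_one : fps R := Fps (fun n => (n == 0%N)%:R).
Definition fps_mul (a b : fps R) : fps R :=
  Fps (fun n => \sum_(i < n.+1) fps_coef a i * fps_coef b (n - i)%N).

Lemma fps_mulA : associative fps_mul.
Proof.
move=> a b c; apply: fpsP => n /=.
under [RHS]eq_bigr => i _ do rewrite mulr_suml.
rewrite (sum_triangle_assoc n
  (fun i j k => fps_coef a i * fps_coef b j * fps_coef c k)).
apply: eq_bigr => i _; rewrite mulr_sumr.
by apply: eq_bigr => j _; rewrite mulrA.
Qed.

Lemma fps_mulC : commutative fps_mul.
Proof.
move=> a b; apply: fpsP => n /=.
rewrite (sum_ord_rev n (fun i j => fps_coef a i * fps_coef b j)).
by apply: eq_bigr => i _; rewrite mulrC.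
Qed.

Lemma fps_mul1 : left_id fps_one fps_mul.
Proof.
move=> a; apply: fpsP => n /=.
rewrite big_ord_recl /= mul1r subn0 big1 ?addr0 // => i _.
by rewrite mul0r.
Qed.

Lemma fps_mulDl : left_distributive fps_mul +%R.
Proof.
move=> a b c; apply: fpsP => n /=.
rewrite -big_split; apply: eq_bigr => i _.
by rewrite mulrDl.
Qed.

Lemma fps_oner_neq0 : fps_one != 0.
Proof.
apply/eqP => /(congr1 (fun f => fps_coef f 0%N)) /= /eqP.
by rewrite oner_eq0.
Qed.

HB.instance Definition _ := GRing.Zmodule_isComNzRing.Build (fps R)
  fps_mulA fps_mulC fps_mul1 fps_mulDl fps_oner_neq0.

End FpsRing.

Section FpsModule.
Variables (R : comNzRingType) (V : lmodType R).

Definition fps_scale (a : fps R) (f : fps V) : fps V :=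
  Fps (fun n => \sum_(i < n.+1) fps_coef a i *: fps_coef f (n - i)%N).

Lemma fps_scaleA (a b : fps R) (f : fps V) :
  fps_scale a (fps_scale b f) = fps_scale (a * b) f.
Proof.
apply: fpsP => n /=.
under [RHS]eq_bigr => i _ do rewrite scaler_suml.
rewrite (sum_triangle_assoc n
  (fun i j k => (fps_coef a i * fps_coef b j) *: fps_coef f k)).
apply: eq_bigr => i _; rewrite scaler_sumr.
by apply: eq_bigr => j _; rewrite scalerA.
Qed.

Lemma fps_scale1 : left_id 1 fps_scale.
Proof.
move=> f; apply: fpsP => n /=.
rewrite big_ord_recl /= scale1r subn0 big1 ?addr0 // => i _.
by rewrite scale0r.
Qed.

Lemma fps_scaleDr : right_distributive fps_scale +%R.
Proof.
move=> a f g; apply: fpsP => n /=.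
rewrite -big_split; apply: eq_bigr => i _.
by rewrite scalerDr.
Qed.

Lemma fps_scaleDl (f : fps V) : {morph fps_scale^~ f : a b / a + b}.
Proof.
move=> a b; apply: fpsP => n /=.
rewrite -big_split; apply: eq_bigr => i _.
by rewrite scalerDl.
Qed.

HB.instance Definition _ := GRing.Zmodule_isLmodule.Build (fps R) (fps V)
  fps_scaleA fps_scale1 fps_scaleDr fps_scaleDl.

Lemma fps_coefZ (a : fps R) (f : fps V) n :
  fps_coef (a *: f) n
  = \sum_(i < n.+1) fps_coef a i *: fps_coef f (n - i)%N.
Proof. by []. Qed.

End FpsModule.

(** The (t-adically continuous) [R[[t]]]-linear extensions to [A[[t]]] of
    [N_t = \sum_i N_i t^i] and [mu_t = \sum_i mu_i t^i]:
    [N_t (\sum_j f_j t^j) = \sum_(i, j) N_i f_j t^(i + j)] and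
    [mu_t (\sum_j f_j t^j) (\sum_k g_k t^k)
       = \sum_(i, j, k) mu_i f_j g_k t^(i + j + k)]. *)
Section Extension.
Variables (R : comNzRingType) (A : lmodType R).
Variables (mu_ : nat -> {bilinear A -> A -> A}) (N_ : nat -> {linear A -> A}).

Definition fps_lin (f : fps A) : fps A :=
  Fps (fun n => \sum_(i < n.+1) N_ i (fps_coef f (n - i)%N)).

Definition fps_bilin (f g : fps A) : fps A :=
  Fps (fun n => \sum_(i < n.+1) \sum_(j < (n - i).+1)
    mu_ i (fps_coef f j) (fps_coef g (n - i - j)%N)).

Lemma fps_lin_is_linear : linear fps_lin.
Proof.
move=> a f g; apply: fpsP => n; rewrite fps_coefD fps_coefZ /=.
under eq_bigr => i _ do rewrite linearD linear_sum.
rewrite big_split; congr (_ + _).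
under eq_bigr => i _ do under eq_bigr => j _ do rewrite linearZ.
rewrite (sum_triangle_swap n
  (fun i j k => fps_coef a j *: N_ i (fps_coef f k))).
by apply: eq_bigr => j _; rewrite scaler_sumr.
Qed.

HB.instance Definition _ :=
  GRing.isLinear.Build (fps R) (fps A) (fps A) *:%R fps_lin fps_lin_is_linear.

Let conv i (f g : fps A) : fps A :=
  Fps (fun m => \sum_(j < m.+1) mu_ i (fps_coef f j) (fps_coef g (m - j)%N)).

Let fps_bilinE f g n :
  fps_coef (fps_bilin f g) n
  = \sum_(i < n.+1) fps_coef (conv i f g) (n - i)%N.
Proof. by []. Qed.

Let fps_bilin_linear (a : fps R) (f f1 f2 g g1 g2 : fps A) :
  (forall i, conv i f g = a *: conv i f1 g1 + conv i f2 g2) ->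
  fps_bilin f g = a *: fps_bilin f1 g1 + fps_bilin f2 g2.
Proof.
move=> H; apply: fpsP => n; rewrite fps_coefD fps_coefZ !fps_bilinE.
under eq_bigr => i _ do rewrite H fps_coefD fps_coefZ.
rewrite big_split; congr (_ + _).
rewrite (sum_triangle_swap n
  (fun i j k => fps_coef a j *: fps_coef (conv i f1 g1) k)).
by apply: eq_bigr => j _; rewrite scaler_sumr.
Qed.

Lemma fps_bilin_is_bilinear :
  bilinear_for (GRing.Scale.Law.clone (fps R) (fps A) *:%R _)
    (GRing.Scale.Law.clone (fps R) (fps A) *:%R _) fps_bilin.
Proof.
split=> [g a f1 f2|f a g1 g2] /=; apply: fps_bilin_linear => i;
  apply: fpsP => n; rewrite fps_coefD fps_coefZ /=.
- under eq_bigr => j _ do rewrite linearDl linear_sumlz.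
  rewrite big_split; congr (_ + _).
  under eq_bigr => j _ do under eq_bigr => k _ do rewrite linearZl_LR.
  rewrite (sum_triangle_assoc n (fun k j m =>
    fps_coef a k *: mu_ i (fps_coef f1 j) (fps_coef g m))).
  by apply: eq_bigr => j _; rewrite scaler_sumr.
- under eq_bigr => j _ do rewrite linearDr linear_sumr.
  rewrite big_split; congr (_ + _).
  under eq_bigr => j _ do under eq_bigr => k _ do rewrite linearZr_LR.
  rewrite (sum_triangle_swap n (fun j k m =>
    fps_coef a k *: mu_ i (fps_coef f j) (fps_coef g1 m))).
  by apply: eq_bigr => j _; rewrite scaler_sumr.
Qed.

HB.instance Definition _ :=
  bilinear_isBilinear.Build (fps R) (fps A) (fps A) (fps A) *:%R *:%R
    fps_bilin fps_bilin_is_bilinear.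

End Extension.

Section Deformation.
Variables (K : fieldType) (A : lmodType K).

Definition formal_deformation (mu : {bilinear A -> A -> A})
    (N : {linear A -> A}) (mu_ : nat -> {bilinear A -> A -> A})
    (N_ : nat -> {linear A -> A}) : Prop :=
  [/\ forall x y, mu_ 0%N x y = mu x y,
      forall x, N_ 0%N x = N x
    & nijenhuis_mock_lie (R := fps K) (A := fps A) (fps_bilin mu_) (fps_lin N_)].

Definition pair_eq0 (mu1 : {bilinear A -> A -> A}) (N1 : {linear A -> A}) :
    Prop :=
  (forall x y, mu1 x y = 0) /\ (forall x, N1 x = 0).

Definition is_infinitesimal (mu_ : nat -> {bilinear A -> A -> A})
    (N_ : nat -> {linear A -> A}) (n : nat) : Prop :=
  [/\ (0 < n)%N,
      forall i, (0 < i < n)%N -> pair_eq0 (mu_ i) (N_ i)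
    & ~ pair_eq0 (mu_ n) (N_ n)].

Definition two_cocycle (mu : {bilinear A -> A -> A}) (N : {linear A -> A})
    (mu1 : {bilinear A -> A -> A}) (N1 : {linear A -> A}) : Prop :=
  (forall x y z,
     mu x (mu1 y z) + mu1 x (mu y z) + mu z (mu1 x y) + mu1 z (mu x y)
     + mu1 y (mu z x) + mu y (mu1 z x) = 0) /\
  (forall x y,
     mu1 (N x) (N y) + mu (N1 x) (N y) + mu (N x) (N1 y)
     - N1 (mu (N x) y) - N (mu (N1 x) y) - N (mu1 (N x) y)
     - N1 (mu x (N y)) - N (mu1 x (N y)) - N (mu x (N1 y))
     + N1 (N (mu x y)) + N (N1 (mu x y)) + N (N (mu1 x y)) = 0).

End Deformation.

(* Main.v *)
Require Import Defs.
From mathcomp Require Import all_boot all_algebra.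
Set Implicit Arguments.
Unset Strict Implicit.
Import GRing.Theory.
Local Open Scope ring_scope.

(** If all terms of the deformation strictly between [0] and [n] vanish, then
    modulo [t^(n+1)] it reads [mu + mu_n t^n] and [N + N_n t^n].  Series of the
    shape [a + b t^n] modulo [t^(n+1)] are stable under sums and under these
    two operations, and since [2n > n] they multiply like dual numbers with
    [eps = t^n]: the [eps]-coefficient of a composite is given by the Leibniz
    rule.  The two cocycle identities are therefore the [eps]-coefficients of
    the Jacobi and Nijenhuis identities of the deformed structure, evaluated at
    constant series.  The stability statements are [dual_number_lin] and
    [dual_number_bilin]. *)

Lemma sum_ends (V : nmodType) (n : nat) (F : nat -> V) :
  (0 < n)%N -> (forall i, (0 < i < n)%N -> F i = 0) ->
  \sum_(i < n.+1) F i = F 0%N + F n.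
Proof.
case: n => // n _ F0.
rewrite big_ord_recl big_ord_recr /= big1 ?add0r // => i _.
by rewrite F0 //= /bump add1n ltnS.
Qed.

(** [f = a + b t^n] modulo [t^(n+1)]. *)
Definition dual_number {V : zmodType} (n : nat) (f : fps V) (a b : V) : Prop :=
  [/\ fps_coef f 0%N = a,
      forall i, (0 < i < n)%N -> fps_coef f i = 0
    & fps_coef f n = b].

Definition fps_const {V : zmodType} (a : V) : fps V :=
  Fps (fun n => if n == 0%N then a else 0).

Lemma dual_number_const {V : zmodType} (n : nat) (a : V) :
  (0 < n)%N -> dual_number n (fps_const a) a 0.
Proof. by case: n => // n _; split=> // -[]. Qed.

Lemma dual_number_add {V : zmodType} (n : nat) (f g : fps V) (a b c d : V) :
  dual_number n f a b -> dual_number n g c d ->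
  dual_number n (f + g) (a + c) (b + d).
Proof.
move=> [fa f0 fb] [gc g0 gd]; split; rewrite ?fps_coefD ?fa ?gc ?fb ?gd //.
by move=> i ltin; rewrite fps_coefD f0 // g0 // addr0.
Qed.

Section FirstOrder.
Variables (R : comNzRingType) (A : lmodType R).
Variables (mu_ : nat -> {bilinear A -> A -> A}) (N_ : nat -> {linear A -> A}).
Variable n : nat.
Hypothesis n_gt0 : (0 < n)%N.
Hypothesis mu_mid0 : forall i, (0 < i < n)%N -> forall x y, mu_ i x y = 0.
Hypothesis N_mid0 : forall i, (0 < i < n)%N -> forall x, N_ i x = 0.

(** The cross terms [N_i f_j] with [i + j = n] and [0 < i < n] vanish, which
    leaves the two summands of the Leibniz rule. *)
Lemma dual_number_lin (f : fps A) (a b : A) :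
  dual_number n f a b ->
  dual_number n (fps_lin N_ f) (N_ 0%N a) (N_ 0%N b + N_ n a).
Proof.
move=> [fa f0 fb]; split=> /=.
- by rewrite big_ord1 fa.
- move=> k /andP[k_gt0 ltkn]; apply: big1 => -[i /= leik] _.
  case: (posnP i) => [->|i_gt0]; first by rewrite subn0 f0 ?k_gt0 // linear0.
  by rewrite N_mid0 // i_gt0 (leq_trans leik).
- rewrite (sum_ends (F := fun i => N_ i (fps_coef f (n - i)))) //.
    by rewrite subn0 subnn fa fb.
  by move=> i ltin; rewrite N_mid0.
Qed.

(** Leibniz rule for a product of three factors, the structure map being one:
    a nonzero term [mu_i f_j g_k] with [i + j + k = n] has all its indices in
    [{0, n}], so exactly one of them is [n]. *)
Lemma dual_number_bilin (f g : fps A) (a b c d : A) :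
  dual_number n f a b -> dual_number n g c d ->
  dual_number n (fps_bilin mu_ f g)
    (mu_ 0%N a c) (mu_ 0%N a d + mu_ 0%N b c + mu_ n a c).
Proof.
move=> [fa f0 fb] [gc g0 gd]; split=> /=.
- by rewrite !big_ord1 fa gc.
- (* Since [0 < k < n], of three indices with sum [k] one is nonzero, and it
     is at most [k], hence strictly between [0] and [n]. *)
  move=> k /andP[k_gt0 ltkn]; apply: big1 => -[i /= leik] _.
  apply: big1 => -[j /= lejk] _.
  case: (posnP i) lejk => [->|i_gt0] lejk; last first.
    by rewrite mu_mid0 // i_gt0 (leq_trans leik).
  rewrite subn0 in lejk *.
  case: (posnP j) => [->|j_gt0]; first by rewrite subn0 g0 ?k_gt0 // linear0r.
  by rewrite f0 ?linear0l // j_gt0 (leq_trans lejk).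
- rewrite (sum_ends (F := fun i => \sum_(j < (n - i).+1)
    mu_ i (fps_coef f j) (fps_coef g (n - i - j)%N))) //; last first.
    by move=> i ltin; apply: big1 => j _; rewrite mu_mid0.
  rewrite subn0 subnn big_ord1 fa gc; congr (_ + _).
  rewrite (sum_ends (F := fun j =>
    mu_ 0%N (fps_coef f j) (fps_coef g (n - j)%N))) //.
    by rewrite subn0 subnn fa fb gc gd.
  by move=> j ltjn; rewrite f0 // linear0l.
Qed.

End FirstOrder.

Theorem theorem3p3 (K : fieldType) (charK0 : [pchar K] =i pred0)
    (A : lmodType K) (mu : {bilinear A -> A -> A}) (N : {linear A -> A})
    (hN : nijenhuis_mock_lie mu N)
    (mu_ : nat -> {bilinear A -> A -> A}) (N_ : nat -> {linear A -> A})
    (hdef : formal_deformation mu N mu_ N_)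
    (n : nat) (hn : is_infinitesimal mu_ N_ n) :
  two_cocycle mu N (mu_ n) (N_ n).
Proof.
case: hdef => mu0 N0 [[_ jacobi_t] nijenhuis_t]; case: hn => n_gt0 mid0 _.
have muT := dual_number_bilin n_gt0 (fun i lt => proj1 (mid0 i lt)).
have NT := dual_number_lin n_gt0 (fun i lt => proj2 (mid0 i lt)).
have cT (a : A) := dual_number_const a n_gt0.
split=> [x y z|x y].
- have J a b c := muT _ _ _ _ _ _ (cT a) (muT _ _ _ _ _ _ (cT b) (cT c)).
  have [_ _] := dual_number_add
    (dual_number_add (J x y z) (J y z x)) (J z x y).
  rewrite jacobi_t => /esym.
  rewrite !mu0 !(linear0l, linear0r, add0r, addr0) => E.
  by rewrite -[RHS]E !addrA [RHS](ACl (1*2*5*6*4*3)).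
- have Nc a := NT _ _ _ (cT a).
  have [_ _] := dual_number_add (muT _ _ _ _ _ _ (Nc x) (Nc y))
    (NT _ _ _ (NT _ _ _ (muT _ _ _ _ _ _ (cT x) (cT y)))).
  have [_ _ ER] := dual_number_add
    (NT _ _ _ (muT _ _ _ _ _ _ (Nc x) (cT y)))
    (NT _ _ _ (muT _ _ _ _ _ _ (cT x) (Nc y))).
  rewrite nijenhuis_t ER => /esym.
  rewrite !mu0 !N0 !(linear0l, linear0r, linear0, add0r, addr0).
  rewrite !linearD /= !addrA => /eqP; rewrite -subr_eq0 => /eqP E.
  by rewrite -[RHS]E !opprD !addrA [RHS](ACl (3*2*1*9*7*8*12*11*10*6*5*4)).
Qed.
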